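(* Let $S$ and $T$ be finite non-empty symmetric normalized sets of integers. If $\Sigma_S = \Sigma_T$, then $k \in S$ implies that at least one of $k$, $k-1$, $k+1$ is in $T$.
   Context: $\mathbb{D}$ is the open unit disc in $\mathbb{C}$. For a non-empty bounded set $S$ of complex numbers, $\Sigma_S = \{ z \in \mathbb{D} \mid \exists\, p_0, p_1, \ldots \in S,\ p_0 \neq 0,\ \sum_{j=0}^\infty p_j z^j = 0 \}$. A set $S$ is symmetric if $S = -S$. A finite non-empty set $S$ of real numbers is normalized if $1 \in S$ and $|s| \geqslant 1$ for every $s \in S$ with $s \neq 0$. *)

(* Defs.v *)
From Stdlib Require Import Reals ZArith Ensembles Finite_sets Image.
From Coquelicot Require Import Coquelicot.

Definition Zset_R (S : Ensemble Z) : Ensemble R := Image.Im Z R S IZR.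
Definition Zset_C (S : Ensemble Z) : Ensemble C :=
  Image.Im Z C S (fun k => RtoC (IZR k)).

(* [is_pseries] asserts convergence of the series; for the bounded sets [S]
   considered here this is automatic when [Cmod z < 1]. *)
Definition Sigma (S : Ensemble C) : Ensemble C :=
  fun z => (Cmod z < 1)%R /\
    exists p : nat -> C,
      (forall j : nat, In C S (p j)) /\
      p 0%nat <> RtoC 0 /\
      @is_pseries C_AbsRing C_NormedModule p z (RtoC 0).

Definition symmetric_set (S : Ensemble C) : Prop :=
  Same_set C S (Image.Im C C S Copp).

Definition normalized (S : Ensemble R) : Prop :=
  In R S 1%R /\ forall s : R, In R S s -> s <> 0%R -> (1 <= Rabs s)%R.

(* Main.v *)
Require Import Defs.
From Stdlib Require Import Reals ZArith Ensembles Finite_sets Image.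
From Coquelicot Require Import Coquelicot.
From Stdlib Require Import Lia Lra IndefiniteDescription.

(** The zero sets are compared on the real axis only, at points slightly to
    the right of the smallest possible zero.

    Let M be the largest element of S.  By symmetry all coefficients lie in
    [-M, M], so a zero x in (0, 1) satisfies 1 <= M x / (1 - x), that is,
    x >= 1 / (M + 1); and 1 / (M + 1) is itself the zero of
    -1 + M z + M z^2 + ... .  Hence the smallest positive point of the zero set
    determines M, and [Sigma_incl_max_le] bounds the elements of T by M.

    At x = 1 / (M + 1) the expansion of 1 with digits at most M is forced:
    falling short of M in one place, by at least 1, can just be made up by all
    the later digits, whose largest total is M x / (1 - x) = 1 in units of that
    place.  For x a little larger this total is only a little above 1, so if one
    expansion of 1 begins with many digits M and the digits after each of these
    contribute a positive amount that is not too small, then every expansion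
    begins with the same digits M.  So, for 0 <= k in S, consider the series
      -1 + M x + ... + M x^m + k x^(m+1) + x^(m+2) - x^(m+3) + x^(m+4) - ... ,
    whose coefficients lie in S.  For large m it has a real zero x as close to
    1 / (M + 1) as desired ([witness_root]).  Since the zero sets agree, some
    series over T vanishes at x too.  Its constant term must be 1 or -1
    ([zero_normalize]), and after a sign change its next m coefficients must be
    M ([witness_digit]).  What is left reads
      t + (a total of absolute value at most about 1) = k + x / (1 + x),
    where t in T is the next coefficient and x / (1 + x) < 1/2 is the value of
    the alternating end.  So |t - k| < 2, and t is k or one of its neighbours.
    Negative k reduce to positive ones by symmetry of both sets. *)

Local Open Scope R_scope.

(** * Integer digit sequences and their power series *)

Definition val (a : nat -> Z) (x : R) : R := PSeries (fun j => IZR (a j)) x.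

Definition digits_le (M : Z) (a : nat -> Z) : Prop :=
  forall j, (Z.abs (a j) <= M)%Z.

Definition cons (k : Z) (a : nat -> Z) : nat -> Z :=
  fun j => match j with O => k | S i => a i end.

Definition tail (a : nat -> Z) : nat -> Z := fun j => a (S j).

Lemma digits_le_cons M k a :
  (Z.abs k <= M)%Z -> digits_le M a -> digits_le M (cons k a).
Proof. intros Hk Ha [|j]; simpl; auto. Qed.

Lemma digits_le_tail M a : digits_le M a -> digits_le M (tail a).
Proof. intros Ha j; apply Ha. Qed.

Lemma digits_le_Rabs M a : digits_le M a -> forall j, Rabs (IZR (a j)) <= IZR M.
Proof. intros Ha j. rewrite <- abs_IZR. apply IZR_le, Ha. Qed.

Lemma digits_CV_radius M a x :
  digits_le M a -> Rabs x < 1 -> Rbar_lt (Rabs x) (CV_radius (fun j => IZR (a j))).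
Proof.
  intros Ha Hx.
  apply Rbar_lt_le_trans with (Finite 1); [exact Hx|].
  apply (proj1 (CV_radius_bounded (fun j => IZR (a j)))).
  exists (IZR M); intros n.
  rewrite pow1, Rmult_1_r. now apply digits_le_Rabs.
Qed.

Lemma ex_val M a x :
  digits_le M a -> Rabs x < 1 -> ex_pseries (fun j => IZR (a j)) x.
Proof. intros Ha Hx; apply CV_radius_inside; eapply digits_CV_radius; eauto. Qed.

Lemma val_continuous M a x :
  digits_le M a -> Rabs x < 1 -> continuity_pt (val a) x.
Proof.
  intros Ha Hx; apply PSeries_continuity; eapply digits_CV_radius; eauto.
Qed.

Lemma val_tail M a x :
  digits_le M a -> Rabs x < 1 -> val a x = IZR (a O) + x * val (tail a) x.
Proof. intros Ha Hx. apply PSeries_decr_1. eapply ex_val; eauto. Qed.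

Lemma val_cons M k a x :
  (Z.abs k <= M)%Z -> digits_le M a -> Rabs x < 1 ->
  val (cons k a) x = IZR k + x * val a x.
Proof.
  intros Hk Ha Hx. apply (val_tail M (cons k a)); auto using digits_le_cons.
Qed.

Lemma val_opp a x : val (fun j => (- a j)%Z) x = - val a x.
Proof.
  unfold val; rewrite <- PSeries_opp.
  apply PSeries_ext; intros n; unfold PS_opp; rewrite opp_IZR; reflexivity.
Qed.

(** Peeling off the first digit reproduces the sequence, so its value v solves
    v = k + x v. *)
Lemma val_const k x : Rabs x < 1 -> val (fun _ => k) x = IZR k / (1 - x).
Proof.
  intros Hx.
  assert (H := val_tail (Z.abs k) (fun _ => k) x (fun _ => Z.le_refl _) Hx).
  unfold tail in H. apply Rabs_def2 in Hx.
  apply Rmult_eq_reg_r with (1 - x); [|lra]. field_simplify; lra.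
Qed.

(** Comparison with the constant sequence M.  In units of a given place, x times
    this bound is the most that all later digits can contribute. *)
Lemma Rabs_val_le M a x :
  digits_le M a -> 0 <= x < 1 -> Rabs (val a x) <= IZR M / (1 - x).
Proof.
  intros Ha Hx.
  assert (Hx' : Rabs x < 1) by (rewrite Rabs_right; lra).
  assert (HM : digits_le M (fun _ => M)) by (intros j; generalize (Ha j); lia).
  rewrite <- val_const by assumption.
  assert (Hle : forall n, 0 <= Rabs (IZR (a n) * x ^ n) <= IZR M * x ^ n).
  { intros n; split; [apply Rabs_pos|].
    rewrite Rabs_mult, (Rabs_right (x ^ n)) by (apply Rle_ge, pow_le; lra).
    apply Rmult_le_compat_r; [apply pow_le; lra|]. now apply digits_le_Rabs. }
  assert (Hex : ex_series (fun n => IZR M * x ^ n)).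
  { apply (proj1 (ex_pseries_R (fun _ => IZR M) x)). now apply (ex_val M (fun _ => M)). }
  apply Rle_trans with (Series (fun n => Rabs (IZR (a n) * x ^ n))).
  - apply Series_Rabs.
    apply (@ex_series_le R_AbsRing R_CompleteNormedModule _ (fun n => IZR M * x ^ n)); auto.
    intros n. change (Rabs (Rabs (IZR (a n) * x ^ n)) <= IZR M * x ^ n).
    rewrite Rabs_Rabsolu. apply Hle.
  - now apply Series_le.
Qed.

(** * Real points of the zero sets *)

(** Convergence in C is convergence of both coordinates, and the partial sums of
    a series with real data have imaginary part 0. *)
Lemma is_pseries_RtoC (a : nat -> R) (x l : R) :
  @is_pseries C_AbsRing C_NormedModule (fun j => RtoC (a j)) (RtoC x) (RtoC l)
  <-> is_pseries a x l.
Proof.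
  assert (Hsum : forall n,
    @sum_n C_NormedModule
      (fun k => @scal C_AbsRing C_NormedModule
                  (@pow_n C_AbsRing (RtoC x) k) (RtoC (a k))) n
    = RtoC (@sum_n R_NormedModule (fun k => scal (pow_n x k) (a k)) n)).
  { assert (Hpow : forall k, @pow_n C_AbsRing (RtoC x) k = RtoC (pow_n x k)).
    { induction k as [|k IH]; [reflexivity|]. simpl. rewrite IH.
      unfold mult; simpl. now rewrite <- RtoC_mult. }
    assert (Hterm : forall k, @scal C_AbsRing C_NormedModule
                  (@pow_n C_AbsRing (RtoC x) k) (RtoC (a k))
                  = RtoC (scal (pow_n x k) (a k))).
    { intros k; rewrite Hpow. unfold scal; simpl. unfold mult; simpl.
      now rewrite <- RtoC_mult. }
    induction n as [|n IH].
    - rewrite !sum_O. apply Hterm.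
    - rewrite !sum_Sn, IH, Hterm. unfold plus; simpl. now rewrite <- RtoC_plus. }
  unfold is_pseries, is_series.
  split; intros H; apply filterlim_locally; intros eps;
    generalize (proj1 (filterlim_locally _ _) H eps); apply filter_imp; intros n Hn.
  (* A ball of C is the product of the balls of its two coordinates. *)
  - rewrite Hsum in Hn. exact (proj1 Hn).
  - rewrite Hsum. split; [exact Hn|]. apply ball_center.
Qed.

(** At real points, membership in a zero set can be handled through integer
    sequences and total real power series; the bound M supplies convergence. *)
Lemma Sigma_RtoC_iff D M x :
  (forall k, In Z D k -> (Z.abs k <= M)%Z) -> Rabs x < 1 ->
  (In C (Sigma (Zset_C D)) (RtoC x) <->
   exists a : nat -> Z, (forall j, In Z D (a j)) /\ a O <> 0%Z /\ val a x = 0).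
Proof.
  intros HD Hx; split.
  - intros [_ [p [Hp [Hp0 Hser]]]].
    destruct (functional_choice
      (fun j k => In Z D k /\ p j = RtoC (IZR k))) as [a Ha].
    { intros j. destruct (Im_inv _ _ _ _ _ (Hp j)) as [k [Hk Hkp]]. now exists k. }
    exists a; split; [intros j; apply Ha|]; split.
    + intros H0; apply Hp0. now rewrite (proj2 (Ha O)), H0.
    + apply is_pseries_unique, is_pseries_RtoC.
      eapply is_pseries_ext; [|exact Hser]. intros n; apply Ha.
  - intros [a [Ha [Ha0 Hval]]]. split; [now rewrite Cmod_R|].
    exists (fun j => RtoC (IZR (a j))); split; [|split].
    + intros j. now exists (a j).
    + intros H; apply Ha0, eq_IZR. now apply RtoC_inj in H.
    + apply is_pseries_RtoC. rewrite <- Hval. apply PSeries_correct.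
      apply (ex_val M); auto. intros j; now apply HD.
Qed.

(** * Equal zero sets force equal largest digits *)

Lemma finite_Z_max (D : Ensemble Z) :
  Finite_sets.Finite Z D -> Inhabited Z D ->
  exists m, In Z D m /\ forall k, In Z D k -> (k <= m)%Z.
Proof.
  induction 1 as [|A HA IH y Hy]; intros [z Hz]; [destruct Hz|].
  destruct (Classical_Prop.classic (Inhabited Z A)) as [Hin|Hout].
  - destruct (IH Hin) as [m [Hm Hmax]].
    destruct (Z_le_gt_dec y m).
    + exists m; split; [now left|]. intros k [k' Hk|k' Hk]; auto.
      now destruct Hk.
    + exists y; split; [now right|]. intros k [k' Hk|k' Hk].
      * apply Hmax in Hk; lia.
      * destruct Hk; lia.
  - exists y; split; [now right|]. intros k [k' Hk|k' Hk].
    + exfalso; apply Hout; now exists k'.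
    + destruct Hk; lia.
Qed.

Lemma symmetric_set_opp D k : symmetric_set (Zset_C D) -> In Z D k -> In Z D (- k)%Z.
Proof.
  intros [H _] Hk.
  destruct (Im_inv _ _ _ _ _ (H _ (Im_def Z C D (fun j => RtoC (IZR j)) k Hk)))
    as [c [Hc Hy]].
  destruct (Im_inv _ _ _ _ _ Hc) as [j [Hj Hjc]]; subst c.
  rewrite <- RtoC_opp in Hy. apply RtoC_inj in Hy.
  rewrite <- opp_IZR in Hy. apply eq_IZR in Hy. subst k.
  now rewrite Z.opp_involutive.
Qed.

Lemma normalized_one D : normalized (Zset_R D) -> In Z D 1%Z.
Proof.
  intros [H _]. destruct (Im_inv _ _ _ _ _ H) as [k [Hk Hk1]].
  now rewrite (eq_IZR _ _ Hk1) in Hk.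
Qed.

Lemma symmetric_Z_max D :
  Finite_sets.Finite Z D -> Inhabited Z D -> symmetric_set (Zset_C D) ->
  exists m, In Z D m /\ forall k, In Z D k -> (Z.abs k <= m)%Z.
Proof.
  intros Hf Hi Hs. destruct (finite_Z_max D Hf Hi) as [m [Hm Hmax]].
  exists m; split; [assumption|]. intros k Hk.
  generalize (Hmax k Hk) (Hmax _ (symmetric_set_opp D k Hs Hk)); lia.
Qed.

Lemma IZR_abs_ge_1 k : k <> 0%Z -> 1 <= Rabs (IZR k).
Proof. intros Hk. rewrite <- abs_IZR. apply (IZR_le 1). lia. Qed.

(** The point 1 / (N + 1), the zero of -1 + N z + N z^2 + ..., lies in the zero set
    of T; digits bounded by M < N contribute less than 1 there, too little to
    cancel a nonzero integer constant term. *)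
Lemma Sigma_incl_max_le S T M N :
  symmetric_set (Zset_C T) ->
  (forall k, In Z S k -> (Z.abs k <= M)%Z) ->
  In Z T N -> In Z T 1%Z -> (forall k, In Z T k -> (Z.abs k <= N)%Z) ->
  Included C (Sigma (Zset_C T)) (Sigma (Zset_C S)) -> (N <= M)%Z.
Proof.
  intros HTs HSM HTN HT1 HTM Hincl.
  destruct (Z_le_gt_dec N M) as [|HNM]; [assumption|exfalso].
  assert (HN : 1 <= IZR N) by (apply (IZR_le 1); apply (HTM 1%Z HT1)).
  set (x := / (IZR N + 1)).
  assert (Hxe : x * (IZR N + 1) = 1) by (unfold x; field; lra).
  assert (Hx : 0 < x < 1) by (split; nra).
  assert (Hx' : Rabs x < 1) by (rewrite Rabs_right; lra).
  assert (Hin : In C (Sigma (Zset_C T)) (RtoC x)).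
  { apply (Sigma_RtoC_iff T N); auto.
    exists (cons (-1) (fun _ => N)); split; [|split]; [|easy|].
    - intros [|j]; simpl; [now apply (symmetric_set_opp T 1)|assumption].
    - rewrite (val_cons N), val_const; [| |apply HTM, (symmetric_set_opp T 1)| |]; auto.
      + apply Rmult_eq_reg_r with (1 - x); [|lra]. field_simplify; lra.
      + intros j; auto. }
  apply Hincl, (Sigma_RtoC_iff S M) in Hin; auto.
  destruct Hin as [a [Ha [Ha0 Hval]]].
  assert (HaM : digits_le M a) by (intros j; auto).
  rewrite (val_tail M) in Hval by assumption.
  assert (Hb := Rabs_val_le M (tail a) x (digits_le_tail _ _ HaM) (conj (Rlt_le _ _ (proj1 Hx)) (proj2 Hx))).
  assert (H1 := IZR_abs_ge_1 _ Ha0).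
  assert (Habs : Rabs (IZR (a O)) = x * Rabs (val (tail a) x)).
  { rewrite <- (Rabs_right x) at 1 by lra. rewrite <- Rabs_mult, <- Rabs_Ropp.
    f_equal; lra. }
  assert (HMN : IZR M <= IZR N - 1) by (rewrite <- minus_IZR; apply IZR_le; lia).
  assert (Hb' : Rabs (val (tail a) x) * (1 - x) <= IZR M).
  { apply Rmult_le_reg_r with (/ (1 - x)); [apply Rinv_0_lt_compat; lra|].
    rewrite Rmult_assoc, Rinv_r by lra. unfold Rdiv in Hb; lra. }
  nra.
Qed.

(** * A series whose early digits are forced *)

Fixpoint lead (m : nat) (M : Z) (c : nat -> Z) : nat -> Z :=
  match m with O => c | S i => cons M (lead i M c) end.

Fixpoint alt (j : nat) : Z := match j with O => 1%Z | S i => (- alt i)%Z end.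

(** The digits after the leading -1 of the series in the introduction.  The end
    1, -1, 1, ... is a stand-in for zeros, which S might not contain; its
    positive value also gives the remainders the lower bound needed to force the
    digits M when k = 0. *)
Definition witness (m : nat) (M k : Z) : nat -> Z := lead m M (cons k alt).

Lemma alt_in D : In Z D 1%Z -> symmetric_set (Zset_C D) -> forall j, In Z D (alt j).
Proof.
  intros H1 Hs; induction j as [|j IH]; simpl; auto using symmetric_set_opp.
Qed.

Lemma witness_in D m M k :
  In Z D 1%Z -> symmetric_set (Zset_C D) -> In Z D M -> In Z D k ->
  forall j, In Z D (witness m M k j).
Proof.
  intros H1 Hs HM Hk. unfold witness.
  induction m as [|m IH]; intros [|j]; simpl; auto using alt_in.
Qed.

Lemma digits_le_alt M : (1 <= M)%Z -> digits_le M alt.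
Proof. intros HM j; induction j; simpl; lia. Qed.

Lemma digits_le_witness m M k :
  (1 <= M)%Z -> (Z.abs k <= M)%Z -> digits_le M (witness m M k).
Proof.
  intros HM Hk; unfold witness; induction m; simpl;
    apply digits_le_cons; auto using digits_le_alt; lia.
Qed.

(** The shifted sequence is the negated one, so the value v solves
    v = 1 - x v. *)
Lemma val_alt x : Rabs x < 1 -> val alt x = / (1 + x).
Proof.
  intros Hx.
  assert (H := val_tail 1 alt x (digits_le_alt 1 (Z.le_refl _)) Hx).
  change (tail alt) with (fun j => (- alt j)%Z) in H. rewrite val_opp in H.
  simpl in H. apply Rabs_def2 in Hx.
  apply Rmult_eq_reg_r with (1 + x); [|lra]. field_simplify; lra.
Qed.

Lemma val_witness_O M k x :
  (1 <= M)%Z -> (Z.abs k <= M)%Z -> Rabs x < 1 ->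
  val (witness 0 M k) x = IZR k + x / (1 + x).
Proof.
  intros HM Hk Hx. unfold witness; simpl.
  rewrite (val_cons M), val_alt; auto using digits_le_alt.
Qed.

Lemma val_witness_S m M k x :
  (1 <= M)%Z -> (Z.abs k <= M)%Z -> Rabs x < 1 ->
  val (witness (S m) M k) x = IZR M + x * val (witness m M k) x.
Proof.
  intros HM Hk Hx. apply (val_cons M); auto using digits_le_witness. lia.
Qed.

Lemma frac_bounds x : 0 < x < 1 -> 0 < x / (1 + x) < 1 / 2.
Proof.
  intros Hx; split.
  - apply Rdiv_lt_0_compat; lra.
  - apply Rmult_lt_reg_r with (1 + x); [lra|].
    unfold Rdiv at 1; rewrite Rmult_assoc, Rinv_l; lra.
Qed.

(** Every remainder of the witness series stays above that of its end, since
    all the digits put in front are nonnegative and those equal to M are at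
    least 1. *)
Lemma val_witness_ge m M k x :
  (1 <= M)%Z -> (0 <= k <= M)%Z -> 0 < x < 1 ->
  x / (1 + x) <= val (witness m M k) x.
Proof.
  intros HM Hk Hx. assert (Hf := frac_bounds x Hx).
  assert (Hx' : Rabs x < 1) by (rewrite Rabs_right; lra).
  induction m as [|m IH].
  - rewrite val_witness_O by (auto; lia).
    assert (0 <= IZR k) by (apply (IZR_le 0); lia). lra.
  - rewrite val_witness_S by (auto; lia).
    assert (1 <= IZR M) by (apply (IZR_le 1); lia). nra.
Qed.

(** The bound M x / (1 - x) on what the digits after a given place contribute
    exceeds 1 by less than x^2 / (1 + x), a lower bound for what the digits of the
    witness contribute after any of its places M. *)
Definition in_window (M : Z) (x : R) : Prop :=
  0 < x < 1 /\ x * (IZR M / (1 - x)) < 1 + x * (x / (1 + x)).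

Lemma x_val_le M t x :
  digits_le M t -> 0 < x < 1 -> Rabs (x * val t x) <= x * (IZR M / (1 - x)).
Proof.
  intros Ht Hx. rewrite Rabs_mult, (Rabs_right x) by lra.
  apply Rmult_le_compat_l; [lra|]. apply Rabs_val_le; auto; lra.
Qed.

(** If the first digit t 0 were at most M - 1, the later digits of t would have
    to contribute at least 1 more than those of the witness do, which is out of
    reach in the window.  So t 0 = M, and cancelling it leaves the same situation
    with m smaller by one.  When no M is left, comparing the remainders gives
    |t 0 - k| < 1/2 + 3/2. *)
Lemma witness_digit m M k x t :
  (1 <= M)%Z -> (0 <= k <= M)%Z -> in_window M x -> digits_le M t ->
  val t x = val (witness m M k) x ->
  exists j, (Z.abs (t j - k) <= 1)%Z.
Proof.
  intros HM Hk [Hx HB]. assert (Hf := frac_bounds x Hx).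
  assert (Hx' : Rabs x < 1) by (rewrite Rabs_right; lra).
  revert t; induction m as [|m IH]; intros t Ht Heq;
    rewrite (val_tail M t) in Heq by assumption;
    assert (Hb := x_val_le M (tail t) x (digits_le_tail _ _ Ht) Hx);
    apply Rabs_le_between in Hb.
  - exists O. rewrite val_witness_O in Heq by (auto; lia).
    assert (Hlt : Rabs (IZR (t O - k)) < 2).
    { rewrite minus_IZR. apply Rabs_def1; nra. }
    rewrite <- abs_IZR in Hlt. apply lt_IZR in Hlt. lia.
  - rewrite val_witness_S in Heq by (auto; lia).
    assert (Hge := val_witness_ge m M k x HM Hk Hx).
    assert (Ht0 : t O = M).
    { assert (H := Ht O). destruct (Z_lt_le_dec (t O) M) as [Hlt|]; [exfalso|lia].
      assert (IZR (t O) <= IZR M - 1) by (rewrite <- minus_IZR; apply IZR_le; lia).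
      nra. }
    rewrite Ht0 in Heq.
    destruct (IH (tail t)) as [j Hj]; auto using digits_le_tail.
    + apply Rmult_eq_reg_l with x; lra.
    + now exists (S j).
Qed.

(** * Real zeros just beyond the smallest one *)

(** Write y = 1 / (M + 1).  The window condition amounts to
    (M + 1) x - 1 < x^2 (1 - x) / (1 + x).  Up to y + y^3 / 6 the left side is at most
    y^2 / 6, while y <= 1/2 keeps x below 2/3, so that the right side is at least
    x^2 / 5 >= y^2 / 5. *)
Lemma in_window_near M x :
  (1 <= M)%Z -> / (IZR M + 1) <= x <= / (IZR M + 1) + (/ (IZR M + 1)) ^ 3 / 6 ->
  in_window M x.
Proof.
  intros HM. apply IZR_le in HM. set (y := / (IZR M + 1)).
  assert (Hy : y * (IZR M + 1) = 1) by (unfold y; field; lra).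
  assert (Hy0 : 0 < y <= 1 / 2) by (split; nra).
  intros Hx.
  assert (Hy2 : 0 < y ^ 2 <= 1 / 4) by (simpl; split; nra).
  assert (Hy3 : 0 < y ^ 3 <= 1 / 8) by (simpl in *; split; nra).
  assert (Hx1 : 0 < x <= 2 / 3) by lra.
  split; [lra|].
  assert (HE : (IZR M + 1) * x - 1 <= y ^ 2 / 6).
  { replace (y ^ 2 / 6) with ((IZR M + 1) * (y + y ^ 3 / 6) - 1).
    - apply Rplus_le_compat_r, Rmult_le_compat_l; lra.
    - replace ((IZR M + 1) * (y + y ^ 3 / 6) - 1)
        with (y * (IZR M + 1) - 1 + (y * (IZR M + 1)) * (y ^ 2 / 6)) by field.
      rewrite Hy; ring. }
  assert (Hxy : y ^ 2 <= x * x) by (simpl; nra).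
  apply Rmult_lt_reg_r with ((1 - x) * (1 + x)); [nra|].
  replace (x * (IZR M / (1 - x)) * ((1 - x) * (1 + x))) with (x * IZR M * (1 + x)) by (field; lra).
  replace ((1 + x * (x / (1 + x))) * ((1 - x) * (1 + x)))
    with ((1 - x) * (1 + x) + x * x * (1 - x)) by (field; lra).
  enough (((IZR M + 1) * x - 1) * (1 + x) < x * x * (1 - x)) by nra.
  apply Rle_lt_trans with (x * x / 6 * (5 / 3)); nra.
Qed.

(** The map v |-> M + x v, which prepends a digit M, has the fixed point
    M / (1 - x) and contracts distances to it by x; the induction starts from the
    value 0. *)
Lemma val_witness_lower m M k x :
  (1 <= M)%Z -> (0 <= k <= M)%Z -> 0 < x < 1 ->
  IZR M / (1 - x) * (1 - x ^ m) <= val (witness m M k) x.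
Proof.
  intros HM Hk Hx.
  assert (Hx' : Rabs x < 1) by (rewrite Rabs_right; lra).
  assert (Hf := frac_bounds x Hx).
  assert (Hge := val_witness_ge 0 M k x HM Hk Hx).
  induction m as [|m IH].
  - simpl; lra.
  - rewrite val_witness_S by (auto; lia).
    replace (IZR M / (1 - x) * (1 - x ^ S m))
      with (IZR M + x * (IZR M / (1 - x) * (1 - x ^ m))) by (simpl; field; lra).
    apply Rplus_le_compat_l, Rmult_le_compat_l; lra.
Qed.

(** Intermediate value theorem between y = 1 / (M + 1), where no digits bounded by
    M contribute more than 1, and z = y + y^3 / 6, where m digits M alone contribute
    more than 1 once m is large. *)
Lemma witness_root M k :
  (1 <= M)%Z -> (0 <= k <= M)%Z ->
  exists m x, in_window M x /\ val (cons (-1) (witness m M k)) x = 0.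
Proof.
  intros HM Hk. assert (HMR := IZR_le _ _ HM).
  set (y := / (IZR M + 1)).
  assert (Hy : y * (IZR M + 1) = 1) by (unfold y; field; lra).
  assert (Hy0 : 0 < y <= 1 / 2) by (split; nra).
  assert (Hy2 : 0 < y ^ 2 <= 1 / 4) by (simpl; split; nra).
  assert (Hy3 : 0 < y ^ 3 <= 1 / 8) by (simpl in *; split; nra).
  set (z := y + y ^ 3 / 6).
  assert (Hz : y < z < 1) by (unfold z; lra).
  assert (Hdig : forall m, digits_le M (witness m M k))
    by (intros m; apply digits_le_witness; lia).
  assert (HR : forall x, y <= x <= z -> Rabs x < 1)
    by (intros x Hx; rewrite Rabs_right; lra).
  assert (Hcons : forall m x, y <= x <= z ->
    val (cons (-1) (witness m M k)) x = -1 + x * val (witness m M k) x)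
    by (intros m x Hx; apply (val_cons M); auto; lia).
  (* The contribution at z of infinitely many digits M. *)
  set (q := z * (IZR M / (1 - z))).
  assert (Hq : 1 < q).
  { apply Rmult_lt_reg_r with (1 - z); [lra|].
    replace (q * (1 - z)) with (z * IZR M) by (unfold q; field; lra). nra. }
  assert (Hm : exists m, 1 < q * (1 - z ^ m)).
  { destruct (pow_lt_1_zero z (HR z (conj (Rlt_le _ _ (proj1 Hz)) (Rle_refl _))) (1 - / q))
      as [m Hm].
    - apply Rlt_0_minus. rewrite <- Rinv_1. apply Rinv_lt_contravar; lra.
    - exists m. assert (H := Rle_lt_trans _ _ _ (Rle_abs _) (Hm m (le_n _))).
      apply Rmult_lt_compat_l with (r := q) in H; [|lra].
      rewrite Rmult_minus_distr_l, Rinv_r in H; lra. }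
  destruct Hm as [m Hm]; exists m.
  assert (Hpos : 0 < val (cons (-1) (witness m M k)) z).
  { rewrite Hcons by lra.
    assert (H := val_witness_lower m M k z HM Hk ltac:(lra)).
    apply Rmult_le_compat_l with (r := z) in H; [|lra].
    unfold q in Hm; lra. }
  assert (Hneg : val (cons (-1) (witness m M k)) y <= 0).
  { rewrite Hcons by lra.
    assert (H := x_val_le M _ y (Hdig m) ltac:(lra)).
    apply Rabs_le_between in H.
    replace (y * (IZR M / (1 - y))) with 1 in H; [lra|].
    apply Rmult_eq_reg_r with (1 - y); [|lra]. field_simplify; lra. }
  destruct Hneg as [Hneg|Hzero].
  - destruct (Ranalysis5.IVT_interv (val (cons (-1) (witness m M k))) y z)
      as [x [Hx Hx0]]; try assumption.
    + intros x Hx. apply (val_continuous M); [|now apply HR].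
      apply digits_le_cons; auto; lia.
    + apply Hz.
    + exists x; split; [|assumption]. now apply in_window_near.
  - exists y; split; [|assumption]. apply in_window_near; auto. fold y z; lra.
Qed.

(** The terms after the constant one contribute less than 2, so the constant
    term is 1 or -1; in the first case all signs are changed. *)
Lemma zero_normalize D M x :
  symmetric_set (Zset_C D) -> (forall k, In Z D k -> (Z.abs k <= M)%Z) ->
  in_window M x -> In C (Sigma (Zset_C D)) (RtoC x) ->
  exists t, (forall j, In Z D (t j)) /\ x * val t x = 1.
Proof.
  intros Hs HD [Hx HB] Hin. assert (Hf := frac_bounds x Hx).
  assert (Hx' : Rabs x < 1) by (rewrite Rabs_right; lra).
  apply (Sigma_RtoC_iff D M) in Hin; auto.
  destruct Hin as [a [Ha [Ha0 Hval]]].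
  assert (HaM : digits_le M a) by (intros j; auto).
  rewrite (val_tail M) in Hval by assumption.
  assert (Hb := x_val_le M (tail a) x (digits_le_tail _ _ HaM) Hx).
  assert (Hlt : Rabs (IZR (a O)) < 2).
  { replace (IZR (a O)) with (- (x * val (tail a) x)) by lra.
    rewrite Rabs_Ropp. nra. }
  rewrite <- abs_IZR in Hlt. apply lt_IZR in Hlt.
  assert (Hcase : a O = 1%Z \/ a O = (-1)%Z) by lia.
  destruct Hcase as [H|H]; rewrite H in Hval.
  - exists (fun j => (- tail a j)%Z); split.
    + intros j; now apply symmetric_set_opp, Ha.
    + rewrite val_opp; lra.
  - exists (tail a); split; [intros j; apply Ha|lra].
Qed.

Lemma nearby_digit_nonneg S T M k :
  symmetric_set (Zset_C S) -> symmetric_set (Zset_C T) ->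
  In Z S 1%Z -> In Z S M ->
  (forall i, In Z S i -> (Z.abs i <= M)%Z) ->
  (forall i, In Z T i -> (Z.abs i <= M)%Z) ->
  Included C (Sigma (Zset_C S)) (Sigma (Zset_C T)) ->
  In Z S k -> (0 <= k)%Z ->
  exists i, In Z T i /\ (Z.abs (i - k) <= 1)%Z.
Proof.
  intros HsS HsT HS1 HSM HS HT Hincl Hk Hk0.
  assert (HM : (1 <= M)%Z) by exact (HS 1%Z HS1).
  assert (HkM : (0 <= k <= M)%Z) by (generalize (HS k Hk); lia).
  destruct (witness_root M k HM HkM) as [m [x [Hw Hval]]].
  assert (Hx' : Rabs x < 1) by (destruct Hw; rewrite Rabs_right; lra).
  assert (Hin : In C (Sigma (Zset_C S)) (RtoC x)).
  { apply (Sigma_RtoC_iff S M); auto.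
    exists (cons (-1) (witness m M k)); split; [|split; [easy|assumption]].
    intros [|j]; simpl; [now apply (symmetric_set_opp S 1)|now apply witness_in]. }
  apply Hincl, (zero_normalize T M) in Hin; auto.
  destruct Hin as [t [Ht Htx]].
  destruct (witness_digit m M k x t) as [j Hj]; auto.
  - intros j; auto.
  - rewrite (val_cons M) in Hval; try apply digits_le_witness; auto; try lia.
    apply Rmult_eq_reg_l with x; [lra|]. destruct Hw; lra.
  - now exists (t j).
Qed.

Theorem theorem6p3 (S T : Ensemble Z)
  (finS : Finite_sets.Finite Z S) (neS : Inhabited Z S)
  (symS : symmetric_set (Zset_C S)) (normS : normalized (Zset_R S))
  (finT : Finite_sets.Finite Z T) (neT : Inhabited Z T)
  (symT : symmetric_set (Zset_C T)) (normT : normalized (Zset_R T))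
  (hST : Same_set C (Sigma (Zset_C S)) (Sigma (Zset_C T))) :
  forall k : Z, In Z S k ->
    In Z T k \/ In Z T (k - 1)%Z \/ In Z T (k + 1)%Z.
Proof.
  intros k Hk. destruct hST as [HST HTS].
  apply normalized_one in normS; apply normalized_one in normT.
  destruct (symmetric_Z_max S finS neS symS) as [M [HM HSM]].
  destruct (symmetric_Z_max T finT neT symT) as [N [HN HTN]].
  assert (HNM : (N <= M)%Z) by (apply (Sigma_incl_max_le S T); auto).
  assert (HTM : forall i, In Z T i -> (Z.abs i <= M)%Z)
    by (intros i Hi; generalize (HTN i Hi); lia).
  assert (Hnear : exists i, In Z T i /\ (Z.abs (i - k) <= 1)%Z).
  { destruct (Z_le_gt_dec 0 k) as [Hk0|Hk0].
    - apply (nearby_digit_nonneg S T M); auto.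
    - destruct (nearby_digit_nonneg S T M (- k)) as [i [Hi Hik]];
        auto using symmetric_set_opp; [lia|].
      exists (- i)%Z; split; [now apply symmetric_set_opp|lia]. }
  destruct Hnear as [i [Hi Hik]].
  assert (Hcase : i = k \/ i = (k - 1)%Z \/ i = (k + 1)%Z) by lia.
  destruct Hcase as [H|[H|H]]; subst i; auto.
Qed.
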